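(* Let $i:B\to S$ be a ring homomorphism such that either (i) $S$ is faithfully flat as a left $B$-module or as a right $B$-module, or (ii) $i(B)$ is a direct summand of $S$ as a $B$-bimodule. Then $\Gamma:\mathrm{Inv}_B(S)\to\mathrm{Aut}_{\mathrm{cor}}(S\otimes_BS)$ is an isomorphism of groups.
   Context: $S$ is a $B$-bimodule via $i$. Sweedler coring $S\otimes_BS$: $S$-bimodule with comultiplication $s\otimes s'\mapsto s\otimes1\otimes s'$, counit $s\otimes s'\mapsto ss'$; $\mathrm{Aut}_{\mathrm{cor}}(S\otimes_BS)$: group of invertible $S$-bimodule endomorphisms compatible with comultiplication and counit. $I_B(S)$: monoid of $B$-subbimodules of $S$ with product $IJ=\{\sum_kx_ky_k\}$ and unit $i(B)$; $\mathrm{Inv}_B(S)$ is its group of invertible elements. For $I\in\mathrm{Inv}_B(S)$ the multiplications $\mathbf m^l_I:S\otimes_BI\to S$ and $\mathbf m^r_I:I\otimes_BS\to S$ are bijective, and $\Gamma(I)=(S\otimes_B\mathbf m^r_I)\circ((\mathbf m^l_I)^{-1}\otimes_BS)$. *)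

(* Defs.v *)
(* Tensor products over a noncommutative ring B are given by
   their universal property. *)
From HB Require Import structures.
From mathcomp Require Import all_boot all_order all_algebra.
From Stdlib Require Import ClassicalEpsilon.
Set Implicit Arguments. Unset Strict Implicit. Unset Printing Implicit Defensive.
Import Order.TTheory GRing.Theory Num.Theory.
Local Open Scope ring_scope.

Definition balanced2 (B : Type) (M N G : zmodType)
  (ra : M -> B -> M) (la : B -> N -> N) (phi : M -> N -> G) : Prop :=
  [/\ forall m m' n, phi (m + m') n = phi m n + phi m' n,
      forall m n n', phi m (n + n') = phi m n + phi m n' &
      forall m b n, phi (ra m b) n = phi m (la b n)].

(* Two formal sums  sum_k m_k (x) n_k  represent the same element of M (x)_B N. *)
Definition teq2 (B : Type) (M N : zmodType)
  (ra : M -> B -> M) (la : B -> N -> N) (l l' : seq (M * N)) : Prop :=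
  forall (G : zmodType) (phi : M -> N -> G), balanced2 ra la phi ->
    \sum_(p <- l) phi p.1 p.2 = \sum_(p <- l') phi p.1 p.2.

Definition exact3 (R : pzRingType) (N1 N2 N3 : lmodType R)
  (f : N1 -> N2) (g : N2 -> N3) : Prop :=
  forall y, g y = 0 <-> exists x, f x = y.

Section Setting.
Variables (B S : pzRingType) (i : {rmorphism B -> S}).

Definition raS (s : S) (b : B) : S := s * i b.
Definition laS (b : B) (s : S) : S := i b * s.

(* S is faithfully flat as a right B-module: S (x)_B - (on left B-modules)
   preserves and reflects exactness. *)
Definition faithfully_flat_right : Prop :=
  forall (N1 N2 N3 : lmodType B) (f : {linear N1 -> N2}) (g : {linear N2 -> N3}),
    exact3 f g <->
    (forall l : seq (S * N2),
       teq2 raS (fun b (n : N3) => b *: n) [seq (p.1, g p.2) | p <- l] [::] <->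
       exists l1 : seq (S * N1),
         teq2 raS (fun b (n : N2) => b *: n) [seq (p.1, f p.2) | p <- l1] l).

(* S is faithfully flat as a left B-module: - (x)_B S (on right B-modules,
   i.e. left B^c-modules) preserves and reflects exactness. *)
Definition faithfully_flat_left : Prop :=
  forall (N1 N2 N3 : lmodType B^c) (f : {linear N1 -> N2}) (g : {linear N2 -> N3}),
    exact3 f g <->
    (forall l : seq (N2 * S),
       teq2 (fun (n : N3) b => (b : B^c) *: n) laS [seq (g p.1, p.2) | p <- l] [::] <->
       exists l1 : seq (N1 * S),
         teq2 (fun (n : N2) b => (b : B^c) *: n) laS [seq (f p.1, p.2) | p <- l1] l).

Definition is_subbimod (I : S -> Prop) : Prop :=
  [/\ I 0, (forall x y, I x -> I y -> I (x - y)),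
      (forall b x, I x -> I (i b * x)) & (forall b x, I x -> I (x * i b))].

Definition iB_direct_summand : Prop :=
  exists J : S -> Prop, [/\ is_subbimod J,
    (forall s, exists b x, J x /\ s = i b + x) &
    (forall b, J (i b) -> i b = 0)].

Definition bimod_prod (I J : S -> Prop) : S -> Prop :=
  fun s => exists l : seq (S * S),
    (forall p, p \in l -> I p.1 /\ J p.2) /\ s = \sum_(p <- l) p.1 * p.2.

Definition bimod_unit : S -> Prop := fun s => exists b, s = i b.

Definition set_eq (I J : S -> Prop) : Prop := forall s, I s <-> J s.

Definition is_invertible (I : S -> Prop) : Prop :=
  is_subbimod I /\ exists J, is_subbimod J /\
    set_eq (bimod_prod I J) bimod_unit /\ set_eq (bimod_prod J I) bimod_unit.

Definition teqSS (l l' : seq (S * S)) : Prop := teq2 raS laS l l'.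

(* (S (x)_B S) (x)_S (S (x)_B S), written via 4-fold formal sums
   (a, b, c, d) standing for (a (x) b) (x)_S (c (x) d). *)
Definition balanced4 (G : zmodType) (phi : S -> S -> S -> S -> G) : Prop :=
  (forall a a' b c d, phi (a + a') b c d = phi a b c d + phi a' b c d) /\
      (forall a b b' c d, phi a (b + b') c d = phi a b c d + phi a b' c d) /\
      (forall a b c c' d, phi a b (c + c') d = phi a b c d + phi a b c' d) /\
      (forall a b c d d', phi a b c (d + d') = phi a b c d + phi a b c d') /\
      (forall a (x : B) b c d, phi (a * i x) b c d = phi a (i x * b) c d) /\
      (forall a b (s : S) c d, phi a (b * s) c d = phi a b (s * c) d) /\
      (forall a b c (x : B) d, phi a b (c * i x) d = phi a b c (i x * d)).

Definition teq4 (l l' : seq (S * S * S * S)) : Prop :=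
  forall (G : zmodType) (phi : S -> S -> S -> S -> G), balanced4 phi ->
    \sum_(p <- l) phi p.1.1.1 p.1.1.2 p.1.2 p.2
    = \sum_(p <- l') phi p.1.1.1 p.1.1.2 p.1.2 p.2.

Definition lact (s : S) (l : seq (S * S)) := [seq (s * p.1, p.2) | p <- l].
Definition ract (l : seq (S * S)) (s : S) := [seq (p.1, p.2 * s) | p <- l].
Definition counit (l : seq (S * S)) : S := \sum_(p <- l) p.1 * p.2.
Definition comult (l : seq (S * S)) : seq (S * S * S * S) :=
  [seq (p.1, 1, 1, p.2) | p <- l].
Definition tens_self (F : seq (S * S) -> seq (S * S)) (l4 : seq (S * S * S * S)) :=
  flatten [seq [seq (x.1, x.2, y.1, y.2) | x <- F [:: (q.1.1.1, q.1.1.2)],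
                                          y <- F [:: (q.1.2, q.2)]] | q <- l4].

(* F (acting on representatives) is an element of Aut_cor(S (x)_B S). *)
Definition is_cor_aut (F : seq (S * S) -> seq (S * S)) : Prop :=
  (forall l l', teqSS l l' -> teqSS (F l) (F l')) /\
      (forall l l', teqSS (F (l ++ l')) (F l ++ F l')) /\
      (forall s l, teqSS (F (lact s l)) (lact s (F l))) /\
      (forall s l, teqSS (F (ract l s)) (ract (F l) s)) /\
      (exists G, (forall l l', teqSS l l' -> teqSS (G l) (G l')) /\
                 forall l, teqSS (F (G l)) l /\ teqSS (G (F l)) l) /\
      (forall l, counit (F l) = counit l) /\
      (forall l, teq4 (comult (F l)) (tens_self F (comult l))).

(* ---------- Gamma(I) = (S (x) m^r_I) o ((m^l_I)^{-1} (x) S) ---------- *)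
(* triples (s, x, s') stand for s (x) x (x) s' in S (x)_B I (x)_B S *)
Definition Gamma_graph (I : S -> Prop) (l y : seq (S * S)) : Prop :=
  exists t : seq (S * S * S), (forall q, q \in t -> I q.1.2) /\
    teqSS [seq (q.1.1 * q.1.2, q.2) | q <- t] l /\   (* (m^l_I (x) S) t = l *)
    teqSS [seq (q.1.1, q.1.2 * q.2) | q <- t] y.     (* (S (x) m^r_I) t = y *)

Definition Gamma (I : S -> Prop) (l : seq (S * S)) : seq (S * S) :=
  epsilon (inhabits [::]) (Gamma_graph I l).

End Setting.

(* Main.v *)
(* Gamma(I) is the bimodule endomorphism s (x) s' |-> s e s' determined by
   e = sum_k y_k (x) x_k, where y_k in I^-1, x_k in I and sum_k y_k x_k = 1.
   Conversely a coring automorphism F is given by the B-central, grouplike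
   element e = F(1 (x) 1), and I is recovered as {s | s e = 1 (x) s}. With e'
   and J attached in the same way to the inverse of F, both IJ and JI lie in
   the equalizer {t | t (x) 1 = 1 (x) t}, so that everything reduces to two facts:
   that this equalizer is i(B), and that 1 belongs to IJ.

   If i(B) is a direct summand with projection pi, one averages with pi:
   sum_k pi(s y_k) x_k lies in I and sum_k y_k pi(x_k s) lies in J.

   If S is right faithfully flat, I is the kernel of a left B-linear map
   S -> S (x)_B S, and by coassociativity e is killed after applying S (x)_B -;
   hence e lifts to S (x)_B I and S I = S. Likewise S J = S, so S (IJ) = S with
   IJ inside i(B), whence IJ = i(B). The left flat case follows by passing to
   converse rings. *)
From HB Require Import structures.
From mathcomp Require Import all_boot all_order all_algebra.
From mathcomp Require Import generic_quotient boolp.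
From Stdlib Require Import ClassicalEpsilon.
Require Import Defs.
Set Implicit Arguments. Unset Strict Implicit. Unset Printing Implicit Defensive.
Import GRing.Theory.
Local Open Scope ring_scope.
Local Open Scope quotient_scope.

(** * Tensors as formal sums *)

Section Balanced.
Variables (B : Type) (M N : zmodType) (ra : M -> B -> M) (la : B -> N -> N).

Lemma balanced2_suml (G : zmodType) (phi : M -> N -> G) (T : Type) (r : seq T) f n :
  balanced2 ra la phi ->
  phi (\sum_(k <- r) f k) n = \sum_(k <- r) phi (f k) n.
Proof.
case=> hD _ _; apply: (big_morph (fun m => phi m n)) => [x y|]; first exact: hD.
by apply: (addrI (phi 0 n)); rewrite -hD !addr0.
Qed.

Lemma balanced2_sumr (G : zmodType) (phi : M -> N -> G) (T : Type) (r : seq T) f m :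
  balanced2 ra la phi ->
  phi m (\sum_(k <- r) f k) = \sum_(k <- r) phi m (f k).
Proof.
case=> _ hD _; apply: (big_morph (phi m)) => [x y|]; first exact: hD.
by apply: (addrI (phi m 0)); rewrite -hD !addr0.
Qed.

Lemma balanced2_0l (G : zmodType) (phi : M -> N -> G) n :
  balanced2 ra la phi -> phi 0 n = 0.
Proof. by move=> /(balanced2_suml ([::] : seq unit) (fun=> 0 : M) n); rewrite !big_nil. Qed.

Lemma balanced2_0r (G : zmodType) (phi : M -> N -> G) m :
  balanced2 ra la phi -> phi m 0 = 0.
Proof. by move=> /(balanced2_sumr ([::] : seq unit) (fun=> 0 : N) m); rewrite !big_nil. Qed.

Lemma balanced2_Nl (G : zmodType) (phi : M -> N -> G) m n :
  balanced2 ra la phi -> phi (- m) n = - phi m n.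
Proof.
move=> h; have [hD _ _] := h; apply: (addrI (phi m n)).
by rewrite -hD !subrr (balanced2_0l _ h).
Qed.

Definition tens_opp (l : seq (M * N)) := [seq (- p.1, p.2) | p <- l].

Lemma tens_oppE (G : zmodType) (phi : M -> N -> G) l : balanced2 ra la phi ->
  \sum_(p <- tens_opp l) phi p.1 p.2 = - \sum_(p <- l) phi p.1 p.2.
Proof.
move=> hphi; rewrite big_map -sumrN; apply: eq_bigr => p _ /=.
exact: balanced2_Nl.
Qed.

End Balanced.

(** * Tensor identities in [S (x)_B S] and the endomorphisms [s (x) s' |-> s e s'] *)

Section Sweedler.
Variables (B S : pzRingType) (i : {rmorphism B -> S}).

Notation bal := (balanced2 (raS i) (laS i)).

Lemma teqSS_sym l l' : teqSS i l l' -> teqSS i l' l.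
Proof. by move=> h G phi /h. Qed.

Lemma teqSS_trans l' l l'' : teqSS i l l' -> teqSS i l' l'' -> teqSS i l l''.
Proof. by move=> h h' G phi hphi; rewrite h // h'. Qed.

Lemma teqSS_cat l1 l1' l2 l2' : teqSS i l1 l1' -> teqSS i l2 l2' ->
  teqSS i (l1 ++ l2) (l1' ++ l2').
Proof. by move=> h h' G phi hphi; rewrite !big_cat /= h // h'. Qed.

Lemma bal_lact (G : zmodType) (phi : S -> S -> G) s :
  bal phi -> bal (fun a b => phi (s * a) b).
Proof.
case=> h1 h2 h3; split=> [m m' n|m n n'|m b n]; rewrite ?mulrDr //.
by rewrite /raS mulrA h3.
Qed.

Lemma bal_ract (G : zmodType) (phi : S -> S -> G) s :
  bal phi -> bal (fun a b => phi a (b * s)).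
Proof.
case=> h1 h2 h3; split=> [m m' n|m n n'|m b n]; rewrite ?mulrDl //.
by rewrite h3 /laS mulrA.
Qed.

Lemma bal_act (G : zmodType) (phi : S -> S -> G) s s' :
  bal phi -> bal (fun a b => phi (s * a) (b * s')).
Proof. by move=> hphi; apply: (bal_lact s (bal_ract s' hphi)). Qed.

Lemma teqSS_lact s l l' : teqSS i l l' -> teqSS i (lact s l) (lact s l').
Proof. by move=> h G phi /(bal_lact s) /h; rewrite !big_map. Qed.

Lemma teqSS_ract s l l' : teqSS i l l' -> teqSS i (ract l s) (ract l' s).
Proof. by move=> h G phi /(bal_ract s) /h; rewrite !big_map. Qed.

Lemma counit_teqSS l l' : teqSS i l l' -> counit l = counit l'.
Proof.
move=> h; apply: (h S (fun a b => a * b)); split=> *; first exact: mulrDl.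
  exact: mulrDr.
by rewrite /raS /laS mulrA.
Qed.

(** Maps out of [S (x)_B S (x)_B S], to which [(S (x)_B S) (x)_S (S (x)_B S)] collapses. *)
Definition balanced3 (G : zmodType) (psi : S -> S -> S -> G) : Prop :=
  [/\ forall a a' b c, psi (a + a') b c = psi a b c + psi a' b c,
      forall a b b' c, psi a (b + b') c = psi a b c + psi a b' c,
      forall a b c c', psi a b (c + c') = psi a b c + psi a b c',
      forall a x b c, psi (a * i x) b c = psi a (i x * b) c &
      forall a b x c, psi a (b * i x) c = psi a b (i x * c)].

Lemma balanced3_12 (G : zmodType) (psi : S -> S -> S -> G) c :
  balanced3 psi -> bal (fun a b => psi a b c).
Proof. by case=> h1 h2 h3 h4 h5; split=> *; rewrite /raS /laS //. Qed.

Lemma balanced3_23 (G : zmodType) (psi : S -> S -> S -> G) a :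
  balanced3 psi -> bal (psi a).
Proof. by case=> h1 h2 h3 h4 h5; split=> *; rewrite /raS /laS //. Qed.

(** The comultiplication is well defined: a scalar crosses the middle 1 in two steps, into it and
    out of it. *)
Lemma balanced3_13 (G : zmodType) (psi : S -> S -> S -> G) :
  balanced3 psi -> bal (fun a c => psi a 1 c).
Proof.
by case=> h1 h2 h3 h4 h5; split=> *; rewrite /raS /laS // h4 mulr1 -[i _]mul1r h5 mul1r.
Qed.

(** Contracts [b (x)_S c] to [bc]; [balanced4_3] goes back by inserting a 1. Comultiplicativity can
    therefore be tested on threefold tensors. *)
Lemma balanced3_4 (G : zmodType) (psi : S -> S -> S -> G) :
  balanced3 psi -> balanced4 i (fun a b c d => psi a (b * c) d).
Proof.
by case=> h1 h2 h3 h4 h5; do 6?split=> *;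
  rewrite ?mulrDl ?mulrDr ?mulrA // ?h1 ?h2 ?h3 // ?h4 ?h5 // mulrA.
Qed.

Lemma balanced4_3 (G : zmodType) (phi : S -> S -> S -> S -> G) :
  balanced4 i phi -> balanced3 (fun a b c => phi a 1 b c).
Proof.
move=> [h1 [h2 [h3 [h4 [h5 [h6 h7]]]]]]; split=> * //.
by rewrite h5 mulr1 -[i _]mul1r h6 mul1r.
Qed.

Lemma balanced4_1 (G : zmodType) (phi : S -> S -> S -> S -> G) a b c d :
  balanced4 i phi -> phi a b c d = phi a 1 (b * c) d.
Proof. by move=> [_ [_ [_ [_ [_ [h _]]]]]]; rewrite -{1}[b]mul1r h. Qed.

(* [s (x) s'] is sent to [s e s']: the [S]-bimodule endomorphism of
   [S (x)_B S] with value [e] at [1 (x) 1]. *)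
Definition insert (e l : seq (S * S)) : seq (S * S) :=
  [seq (p.1 * q.1, q.2 * p.2) | p <- l, q <- e].

Lemma sum_insert (G : zmodType) (phi : S -> S -> G) e l :
  \sum_(p <- insert e l) phi p.1 p.2
  = \sum_(p <- l) \sum_(q <- e) phi (p.1 * q.1) (q.2 * p.2).
Proof. by rewrite big_allpairs_dep. Qed.

(** The condition that makes [insert e] respect [s b (x) s' = s (x) b s']. *)
Definition central e := forall b, teqSS i (lact (i b) e) (ract e (i b)).

Lemma bal_insert (G : zmodType) (phi : S -> S -> G) e : central e -> bal phi ->
  bal (fun a c => \sum_(q <- e) phi (a * q.1) (q.2 * c)).
Proof.
move=> ce hphi; have [h1 h2 h3] := hphi; split=> [m m' n|m n n'|m b n].
- by rewrite -big_split; apply: eq_bigr => q _ /=; rewrite mulrDl h1.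
- by rewrite -big_split; apply: eq_bigr => q _ /=; rewrite mulrDr h2.
- have := ce b _ _ (bal_act m n hphi); rewrite !big_map /= /raS /laS.
  move=> eq_b; transitivity (\sum_(q <- e) phi (m * (i b * q.1)) (q.2 * n)).
    by apply: eq_bigr => q _; rewrite mulrA.
  by rewrite eq_b; apply: eq_bigr => q _; rewrite mulrA.
Qed.

Lemma insert_teqSS e l l' : central e ->
  teqSS i l l' -> teqSS i (insert e l) (insert e l').
Proof. by move=> ce h G phi hphi; rewrite !sum_insert; apply: h (bal_insert ce hphi). Qed.

Lemma insert_teqSSl e e' l : teqSS i e e' -> teqSS i (insert e l) (insert e' l).
Proof.
move=> h G phi hphi; rewrite !sum_insert; apply: eq_bigr => p _.
exact: h (bal_act p.1 p.2 hphi).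
Qed.

Lemma insert_insert e e' l :
  teqSS i (insert e (insert e' l)) (insert (insert e e') l).
Proof.
move=> G phi hphi; rewrite !sum_insert big_allpairs_dep; apply: eq_bigr => p _.
rewrite big_allpairs_dep; apply: eq_bigr => q _ /=; apply: eq_bigr => r _.
by rewrite !mulrA.
Qed.

Lemma insert1 l : teqSS i (insert [:: (1, 1)] l) l.
Proof.
move=> G phi hphi; rewrite sum_insert; apply: eq_bigr => p _.
by rewrite big_seq1 mulr1 mul1r.
Qed.

Lemma insert_unit e : teqSS i (insert e [:: (1, 1)]) e.
Proof.
move=> G phi hphi; rewrite sum_insert big_seq1; apply: eq_bigr => p _.
by rewrite mulr1 mul1r.
Qed.

Lemma insert_l1 e s : insert e [:: (s, 1)] = lact s e.
Proof. by rewrite /insert /= cats0; apply: eq_map => p; rewrite mulr1. Qed.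

Lemma insert_1r e s : insert e [:: (1, s)] = ract e s.
Proof. by rewrite /insert /= cats0; apply: eq_map => p; rewrite mul1r. Qed.

Lemma insert_cat e l l' : insert e (l ++ l') = insert e l ++ insert e l'.
Proof. by rewrite /insert map_cat flatten_cat. Qed.

Lemma insert_lact e s l : teqSS i (insert e (lact s l)) (lact s (insert e l)).
Proof.
move=> G phi _; rewrite sum_insert !big_map /= big_allpairs_dep; apply: eq_bigr => p _.
by apply: eq_bigr => q _; rewrite mulrA.
Qed.

Lemma insert_ract e s l : teqSS i (insert e (ract l s)) (ract (insert e l) s).
Proof.
move=> G phi _; rewrite sum_insert !big_map /= big_allpairs_dep; apply: eq_bigr => p _.
by apply: eq_bigr => q _; rewrite mulrA.
Qed.

Lemma counit_insert e l : counit e = 1 -> counit (insert e l) = counit l.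
Proof.
rewrite /counit => he; rewrite big_allpairs_dep; apply: eq_bigr => p _ /=.
rewrite -[in RHS](mulr1 p.1) -he mulr_sumr mulr_suml; apply: eq_bigr => q _.
by rewrite !mulrA.
Qed.

(** [Delta(e) = e (x)_S e], tested on maps out of [S (x)_B S (x)_B S]. *)
Definition comultiplicative e :=
  forall (G : zmodType) (psi : S -> S -> S -> G), balanced3 psi ->
  \sum_(p <- e) psi p.1 1 p.2
  = \sum_(p <- e) \sum_(q <- e) psi p.1 (p.2 * q.1) q.2.

Lemma balanced3_act (G : zmodType) (psi : S -> S -> S -> G) s s' :
  balanced3 psi -> balanced3 (fun a b c => psi (s * a) b (c * s')).
Proof.
case=> h1 h2 h3 h4 h5; split=> *;
by rewrite ?mulrDr ?mulrDl ?mulrA ?h1 ?h2 ?h3 ?h4 ?h5 ?mulrA.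
Qed.

(** [F] is compared with [insert e] only up to equality of tensors, because [Gamma] picks its
    representatives by [epsilon]. The inverse of [F] is [insert e']. *)
Lemma insert_is_cor_aut e e' F : central e -> central e' -> counit e = 1 ->
  comultiplicative e ->
  teqSS i (insert e e') [:: (1, 1)] -> teqSS i (insert e' e) [:: (1, 1)] ->
  (forall l, teqSS i (F l) (insert e l)) -> is_cor_aut i F.
Proof.
move=> ce ce' ue me h1 h2 hF.
have hF' l : teqSS i (insert e l) (F l) by apply: teqSS_sym.
split=> [l l' h|]; first exact: teqSS_trans (hF l) (teqSS_trans (insert_teqSS ce h) (hF' _)).
split=> [l l'|].
  by apply: teqSS_trans (hF _) _; rewrite insert_cat; apply: teqSS_cat.
split=> [s l|].
  by apply: teqSS_trans (hF _) (teqSS_trans (insert_lact _ _ _) _); apply: teqSS_lact.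
split=> [s l|].
  by apply: teqSS_trans (hF _) (teqSS_trans (insert_ract _ _ _) _); apply: teqSS_ract.
split.
  exists (insert e'); split=> [l l' h|l]; first exact: insert_teqSS.
  have ins d d' : teqSS i (insert d d') [:: (1, 1)] -> teqSS i (insert d (insert d' l)) l.
    move=> h; apply: teqSS_trans (insert_insert _ _ _) _.
    by apply: teqSS_trans (insert_teqSSl l h) _; apply: insert1.
  split; first exact: teqSS_trans (hF _) (ins _ _ h1).
  by apply: teqSS_trans (insert_teqSS ce' (hF l)) _; apply: ins.
split=> [l|l G phi hphi]; first by rewrite (counit_teqSS (hF l)) counit_insert.
have [b1 [b2 [b3 [b4 [b5 [b6 b7]]]]]] := hphi.
rewrite big_map /= /tens_self big_flatten !big_map /=.
transitivity (\sum_(p <- insert e l) phi p.1 1 1 p.2).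
  have hb := balanced3_13 (balanced4_3 hphi); exact: hF l _ _ hb.
rewrite big_allpairs_dep; apply: eq_bigr => p _ /=.
rewrite big_allpairs_dep /=.
(* [tens_self] evaluates [F] on [s (x) 1] and on [1 (x) s']; each value is replaced by [insert e] in
   turn, giving [s e (x)_S e s']. *)
transitivity (\sum_(q <- insert e [:: (p.1, 1)]) \sum_(r <- F [:: (1, p.2)])
    phi q.1 q.2 r.1 r.2); last first.
  apply/esym; apply: (hF [:: (p.1, 1)] G (fun a b => \sum_(r <- _) phi a b r.1 r.2)).
  by split=> *; rewrite -?big_split; apply: eq_bigr => r _ //=; rewrite /raS b5.
rewrite insert_l1 big_map.
transitivity (\sum_(q <- e) \sum_(r <- ract e p.2) phi (p.1 * q.1) q.2 r.1 r.2); last first.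
  apply: eq_bigr => q _; apply/esym; rewrite -insert_1r.
  by apply: (hF [:: (1, p.2)]); split=> *; rewrite /raS.
have := me _ _ (balanced3_act p.1 p.2 (balanced4_3 hphi)) => /= ->.
apply: eq_bigr => q _; rewrite big_map; apply: eq_bigr => r _ /=.
by rewrite [RHS](balanced4_1 _ _ _ _ hphi).
Qed.

(** * Invertible bimodules *)

Lemma bal_unit (G : zmodType) (phi : S -> S -> G) a s c :
  bal phi -> bimod_unit i s -> phi (a * s) c = phi a (s * c).
Proof. by move=> [_ _ h] [b ->]; apply: h. Qed.

(* [e] represents [1 (x) 1] through [J (x)_B I = B], where [J] is inverse to [I]. *)
Definition frame (I : S -> Prop) (e : seq (S * S)) : Prop :=
  [/\ is_subbimod i I, (forall p, p \in e -> I p.2),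
      (forall x p, I x -> p \in e -> bimod_unit i (x * p.1)) & counit e = 1].

(** [x e = 1 (x) x] for [x] in [I]: each [x y_k] lies in [i(B)], so it crosses the tensor sign, and
    then [sum_k y_k x_k = 1]. *)
Lemma frame_sum (G : zmodType) (phi : S -> S -> G) I e a x c :
  frame I e -> bal phi -> I x ->
  \sum_(q <- e) phi (a * x * q.1) (q.2 * c) = phi a (x * c).
Proof.
move=> [_ _ eB e1] hphi xI.
transitivity (\sum_(q <- e) phi a (x * (q.1 * q.2) * c)).
  rewrite big_seq [RHS]big_seq; apply: eq_bigr => q qe.
  by rewrite -mulrA (bal_unit _ _ hphi) ?mulrA //; apply: eB.
rewrite -(balanced2_sumr _ _ _ hphi) -mulr_suml -mulr_sumr.
by move: e1; rewrite /counit => ->; rewrite mulr1.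
Qed.

(** The double sum of [y_p x_p b y_q (x) x_q] equals [b e] when summed over [p] first, and [e b]
    when summed over [q] first, since [x_p b] is in [I]. *)
Lemma frame_central I e : frame I e -> central e.
Proof.
move=> fe b G phi hphi; have [[_ _ _ Ir] eI eB e1] := fe; rewrite !big_map /=.
transitivity (\sum_(p <- e) \sum_(q <- e) phi (p.1 * (p.2 * i b) * q.1) (q.2 * 1)); last first.
  rewrite big_seq [RHS]big_seq; apply: eq_bigr => p pe.
  by rewrite (frame_sum _ _ fe hphi) ?mulr1 //; apply/Ir/eI.
rewrite exchange_big /=; apply: eq_bigr => q _.
rewrite -(balanced2_suml _ _ _ hphi) -mulr_suml; congr (phi (_ * _) _); last by rewrite mulr1.
under eq_bigr do rewrite mulrA.
by rewrite -mulr_suml; move: e1; rewrite /counit => ->; rewrite mul1r.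
Qed.

Lemma frame_comultiplicative I e : frame I e -> comultiplicative e.
Proof.
move=> fe G psi hpsi; have [_ eI _ _] := fe.
rewrite big_seq [RHS]big_seq; apply: eq_bigr => p /eI pI.
have := frame_sum 1 1 fe (balanced3_23 p.1 hpsi) pI.
by rewrite mul1r mulr1 => <-; apply: eq_bigr => q _; rewrite mulr1.
Qed.

(** For [x] in [I], [s x e s' = s (x) x s']. The graph is thus single-valued up to equality of
    tensors, and the choice made by [epsilon] does not matter. *)
Lemma Gamma_graph_insert I e l y : frame I e ->
  Gamma_graph i I l y -> teqSS i y (insert e l).
Proof.
move=> fe [t [tI [tl ty]]] G phi hphi.
rewrite -(ty _ _ hphi) sum_insert big_map.
rewrite -(tl _ _ (bal_insert (frame_central fe) hphi)) big_map.
rewrite big_seq [RHS]big_seq; apply: eq_bigr => p /tI pI /=.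
by rewrite (frame_sum _ _ fe hphi).
Qed.

(** As [1 = sum_k y_k x_k], the triples [(s y_k, x_k, s')] give a preimage of [s (x) s'] under
    [m^l_I (x) S]. *)
Lemma insert_Gamma_graph I e l : frame I e -> Gamma_graph i I l (insert e l).
Proof.
move=> [_ eI eB e1]; exists [seq (p.1 * q.1, q.2, p.2) | p <- l, q <- e].
split; first by move=> _ /allpairsP [[p q] [_ qe ->]] /=; apply: eI.
split=> G phi hphi; rewrite big_map big_allpairs_dep /=; last by rewrite sum_insert.
apply: eq_bigr => p _; rewrite -(balanced2_suml _ _ _ hphi).
under eq_bigr do rewrite -mulrA.
by rewrite -mulr_sumr; move: e1; rewrite /counit => ->; rewrite mulr1.
Qed.

Lemma Gamma_insert I e l : frame I e -> teqSS i (Gamma i I l) (insert e l).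
Proof.
move=> fe; apply: (Gamma_graph_insert fe); apply: epsilon_spec.
by exists (insert e l); apply: insert_Gamma_graph.
Qed.

Definition inverse_bimod I J :=
  [/\ is_subbimod i I, is_subbimod i J, set_eq (bimod_prod I J) (bimod_unit i) &
     set_eq (bimod_prod J I) (bimod_unit i)].

Lemma inverse_bimod_sym I J : inverse_bimod I J -> inverse_bimod J I.
Proof. by case. Qed.

Lemma invertibleP I : is_invertible i I <-> exists J, inverse_bimod I J.
Proof.
split=> [[sI [J [sJ [h1 h2]]]]|[J [sI sJ h1 h2]]]; first by exists J.
by split=> //; exists J.
Qed.

Lemma bimod_unit1 : bimod_unit i 1. Proof. by exists 1; rewrite rmorph1. Qed.

Lemma mem_bimod_prod (I J : S -> Prop) x y : I x -> J y -> bimod_prod I J (x * y).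
Proof.
by move=> xI yJ; exists [:: (x, y)]; split=> [p|]; rewrite ?big_seq1 // inE => /eqP ->.
Qed.

Lemma inverse_bimod_frame I J : inverse_bimod I J ->
  exists e, frame I e /\ (forall p, p \in e -> J p.1).
Proof.
move=> [sI sJ hIJ hJI]; have [e [he e1]] := (hJI 1).2 bimod_unit1.
exists e; split=> [|p /he []//]; split=> //; first by move=> p /he [].
by move=> x p xI /he [pJ _]; apply/hIJ/mem_bimod_prod.
Qed.

(** The left entries [p.1] of [f] lie in [I], so [p.1 e p.2 = 1 (x) p.1 p.2], and these products sum
    to 1. *)
Lemma frame_cancel I J e f : frame I e -> frame J f ->
  (forall p, p \in f -> I p.1) -> teqSS i (insert e f) [:: (1, 1)].
Proof.
move=> fe [_ _ _ f1] fI G phi hphi; rewrite sum_insert big_seq1 /=.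
transitivity (\sum_(p <- f) phi 1 (p.1 * p.2)).
  rewrite big_seq [RHS]big_seq; apply: eq_bigr => p /fI pI.
  by rewrite -(frame_sum 1 p.2 fe hphi pI); apply: eq_bigr => q _; rewrite mul1r.
by rewrite -(balanced2_sumr _ _ _ hphi); move: f1; rewrite /counit => ->.
Qed.

Lemma subbimod_sum I (T : eqType) (r : seq T) f : is_subbimod i I ->
  (forall k, k \in r -> I (f k)) -> I (\sum_(k <- r) f k).
Proof.
move=> [I0 IB _ _] rI; rewrite big_seq; elim/big_rec: _ => [|k x kr xI] //.
by rewrite -[x]opprK; apply: (IB); [apply: rI | rewrite -sub0r; apply: IB].
Qed.

Lemma bimod_prod_subbimod I J :
  is_subbimod i I -> is_subbimod i J -> is_subbimod i (bimod_prod I J).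
Proof.
move=> [I0 IB Il Ir] [J0 JB Jl Jr]; split.
- by exists [::]; rewrite big_nil.
- move=> _ _ [l [lI ->]] [l' [lI' ->]]; exists (l ++ tens_opp l'); split.
    move=> p; rewrite mem_cat => /orP [/lI //|/mapP [q /lI' [q1 q2] ->]] /=.
    by split=> //; rewrite -sub0r; apply: IB.
  rewrite big_cat big_map -sumrN; congr (_ + _).
  by apply: eq_bigr => p _; rewrite /= mulNr.
- move=> b _ [l [lI ->]]; exists (lact (i b) l); split.
    by move=> _ /mapP [p /lI [p1 p2] ->]; split=> //; apply: Il.
  by rewrite big_map mulr_sumr; apply: eq_bigr => p _; rewrite mulrA.
- move=> b _ [l [lI ->]]; exists (ract l (i b)); split.
    by move=> _ /mapP [p /lI [p1 p2] ->]; split=> //; apply: Jr.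
  by rewrite big_map mulr_suml; apply: eq_bigr => p _; rewrite mulrA.
Qed.

Lemma bimod_unit_subbimod : is_subbimod i (bimod_unit i).
Proof.
split; first by exists 0; rewrite rmorph0.
- by move=> _ _ [b ->] [c ->]; exists (b - c); rewrite rmorphB.
- by move=> b _ [c ->]; exists (b * c); rewrite rmorphM.
- by move=> b _ [c ->]; exists (c * b); rewrite rmorphM.
Qed.

(** Makes [Gamma] multiplicative: the element attached to [IJ] is the one that represents the
    composite of the two endomorphisms. *)
Lemma frame_prod I J e f : frame I e -> frame J f ->
  frame (bimod_prod I J) (insert e f).
Proof.
move=> [sI eI eB e1] [sJ fJ fB f1]; split.
- exact: bimod_prod_subbimod.
- by move=> _ /allpairsP [[p q] [pf qe ->]]; apply: mem_bimod_prod; [apply: eI|apply: fJ].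
- move=> _ _ [l [lIJ ->]] /allpairsP [[p q] [pf qe ->]] /=.
  rewrite mulr_suml; apply: subbimod_sum bimod_unit_subbimod _ => r /lIJ [r1 r2].
  have [b rpE] := fB _ _ r2 pf; have [_ _ _ Ir] := sI.
  by rewrite -mulrA [r.2 * _]mulrA rpE mulrA; apply: eB => //; apply: Ir.
- by rewrite counit_insert.
Qed.

Lemma Gamma_is_cor_aut I : is_invertible i I -> is_cor_aut i (Gamma i I).
Proof.
move=> /invertibleP [J IJ].
have [e [fe eJ]] := inverse_bimod_frame IJ.
have [f [ff fI]] := inverse_bimod_frame (inverse_bimod_sym IJ).
apply: (@insert_is_cor_aut e f) => [||||||l].
- exact: frame_central fe.
- exact: frame_central ff.
- by case: fe.
- exact: frame_comultiplicative fe.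
- exact: frame_cancel fe ff fI.
- exact: frame_cancel ff fe eJ.
- exact: Gamma_insert.
Qed.

Lemma Gamma_prod I J l : is_invertible i I -> is_invertible i J ->
  teqSS i (Gamma i (bimod_prod I J) l) (Gamma i I (Gamma i J l)).
Proof.
move=> /invertibleP [I' /inverse_bimod_frame [e [fe _]]].
move=> /invertibleP [J' /inverse_bimod_frame [f [ff _]]].
apply: teqSS_trans (Gamma_insert _ (frame_prod fe ff)) _.
apply: teqSS_sym; apply: teqSS_trans (Gamma_insert _ fe) _.
apply: (teqSS_trans _ (insert_insert _ _ _)).
exact: insert_teqSS (frame_central fe) (Gamma_insert _ ff).
Qed.

(** * Injectivity of [Gamma] *)

Definition sweedler_equalizer : Prop :=
  forall s, teqSS i [:: (s, 1)] [:: (1, s)] -> bimod_unit i s.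

Lemma insert_lframe I e s : frame I e -> I s -> teqSS i (lact s e) [:: (1, s)].
Proof.
move=> fe sI G phi hphi; rewrite big_seq1 big_map.
have := frame_sum 1 1 fe hphi sI; rewrite mul1r !mulr1 /= => <-.
by apply: eq_bigr => q _; rewrite mulr1.
Qed.

(** With [K] inverse to [J], comparing both maps at [s (x) 1] gives [s f = 1 (x) s], hence
    [s (x) 1 = g s]. For [y] in [K] then [y s (x) 1 = y g s = 1 (x) y s], so [K s] lies in [i(B)]
    and [s] in [J K s], which lies in [J]. *)
Lemma Gamma_subset I J : sweedler_equalizer ->
  is_invertible i I -> is_invertible i J ->
  (forall l, teqSS i (Gamma i I l) (Gamma i J l)) -> forall s, I s -> J s.
Proof.
move=> eqB /invertibleP [I' /inverse_bimod_frame [e [fe _]]].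
move=> /invertibleP [K JK] GIJ s sI.
have [f [ff fK]] := inverse_bimod_frame JK.
have [g [fg gJ]] := inverse_bimod_frame (inverse_bimod_sym JK).
have sf : teqSS i (lact s f) [:: (1, s)].
  apply: (teqSS_trans _ (insert_lframe fe sI)); rewrite -!insert_l1.
  apply: (teqSS_trans _ (Gamma_insert _ fe)); apply: (teqSS_trans _ (teqSS_sym (GIJ _))).
  by apply: teqSS_sym; apply: Gamma_insert.
have sg : teqSS i [:: (s, 1)] (ract g s).
  rewrite -insert_1r; apply: (teqSS_trans _ (insert_teqSS (frame_central fg) sf)).
  rewrite -insert_l1; apply: teqSS_sym; apply: teqSS_trans (insert_insert _ _ _) _.
  by apply: teqSS_trans (insert_teqSSl _ (frame_cancel fg ff fK)) _; apply: insert1.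
have KsB y : K y -> bimod_unit i (y * s).
  move=> yK; apply: eqB.
  apply: teqSS_trans (teqSS_lact y sg) _.
  by have := teqSS_ract s (insert_lframe fg yK); rewrite /lact /ract -!map_comp.
have [sJ _ _ _] := JK; have [_ gK _ g1] := fg.
rewrite -[s]mul1r -g1 mulr_suml; apply: (subbimod_sum sJ) => p pg.
by rewrite -mulrA; have [_ _ _ Jr] := sJ; have [b ->] := KsB _ (gK _ pg); apply/Jr/gJ.
Qed.
(** * Coring automorphisms as grouplike elements *)

Definition grouplike e := [/\ central e, counit e = 1 & comultiplicative e].

Definition inverse_grouplike e e' :=
  [/\ grouplike e, grouplike e', teqSS i (insert e e') [:: (1, 1)] &
     teqSS i (insert e' e) [:: (1, 1)]].

Lemma inverse_grouplike_sym e e' : inverse_grouplike e e' -> inverse_grouplike e' e.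
Proof. by case. Qed.

Definition coinv e : S -> Prop := fun s => teqSS i (lact s e) [:: (1, s)].

(** Apply the inverse endomorphism to both sides of [s e = 1 (x) s]. *)
Lemma coinvP e e' s : inverse_grouplike e e' ->
  coinv e s <-> teqSS i (ract e' s) [:: (s, 1)].
Proof.
move=> [[ce _ _] [ce' _ _] h h']; have ins d d' l :
    teqSS i (insert d d') [:: (1, 1)] -> teqSS i (insert d (insert d' l)) l.
  move=> hd; apply: teqSS_trans (insert_insert _ _ _) _.
  by apply: teqSS_trans (insert_teqSSl l hd) _; apply: insert1.
rewrite /coinv -insert_l1 -insert_1r; split=> hs.
  apply: (teqSS_trans _ (ins _ _ [:: (s, 1)] h')).
  by apply: insert_teqSS => //; apply: teqSS_sym.
apply: (teqSS_trans _ (ins _ _ [:: (1, s)] h)).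
by apply: insert_teqSS => //; apply: teqSS_sym.
Qed.

Lemma bal_opp (G : zmodType) (phi : S -> S -> G) :
  bal phi -> bal (fun a b => - phi a b).
Proof. by case=> h1 h2 h3; split=> *; rewrite ?h1 ?h2 ?h3 ?opprD. Qed.

Lemma coinv_subbimod e : central e -> is_subbimod i (coinv e).
Proof.
move=> ce; split.
- move=> G phi hphi; rewrite big_seq1 big_map (balanced2_0r _ hphi).
  by rewrite big1 // => p _; rewrite mul0r (balanced2_0l _ hphi).
- move=> x y hx hy G phi hphi; have [h1 h2 _] := hphi.
  have hN := bal_opp hphi.
  rewrite big_seq1 big_map /=.
  have := hx _ _ hphi; have := hy _ _ hN; rewrite !big_seq1 !big_map /=.
  rewrite h2 => ey ex.
  have -> : phi 1 (- y) = - phi 1 y.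
    by apply: (addrI (phi 1 y)); rewrite -h2 !subrr (balanced2_0r _ hphi).
  rewrite -ex -ey -big_split; apply: eq_bigr => p _ /=.
  by rewrite mulrBl h1 (balanced2_Nl _ _ hphi).
- move=> b x hx.
  move=> G phi hphi; have [_ _ h3] := hphi.
  transitivity (\sum_(p <- lact (i b) (lact x e)) phi p.1 p.2).
    by rewrite !big_map; apply: eq_bigr => p _ /=; rewrite mulrA.
  rewrite (teqSS_lact _ hx) // !big_seq1 /= mulr1.
  by have := h3 1 b x; rewrite /raS /laS mul1r.
- move=> b x hx.
  apply: (teqSS_trans _ (teqSS_ract (i b) hx)) => G phi hphi.
  have := ce b _ _ (bal_lact x hphi); rewrite !big_map /= => <-.
  by apply: eq_bigr => p _; rewrite mulrA.
Qed.

(** By [coinvP], [e y = y (x) 1]; so [x e y] equals [xy (x) 1] and also [1 (x) xy]. *)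
Lemma coinv_mul e e' x y : inverse_grouplike e e' -> coinv e x -> coinv e' y ->
  teqSS i [:: (x * y, 1)] [:: (1, x * y)].
Proof.
move=> ee hx /(coinvP y (inverse_grouplike_sym ee)) hy.
apply: (@teqSS_trans (ract (lact x e) y)); last exact: teqSS_ract hx.
apply: teqSS_sym; have := teqSS_lact x hy.
by rewrite /lact /ract -!map_comp.
Qed.

(** Quantifying over all inverse pairs covers [JI] as well as [IJ], since the roles of [e] and [e']
    can be exchanged. *)
Definition coinv_generate : Prop := forall e e', inverse_grouplike e e' ->
  bimod_prod (coinv e) (coinv e') 1.

Lemma coinv_inverse e e' : sweedler_equalizer -> coinv_generate ->
  inverse_grouplike e e' -> inverse_bimod (coinv e) (coinv e').
Proof.
move=> eqB gen.
have half d d' : inverse_grouplike d d' ->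
    set_eq (bimod_prod (coinv d) (coinv d')) (bimod_unit i).
  move=> dd s; have [[cd _ _] [cd' _ _] _ _] := dd; split.
    move=> [l [hl ->]]; apply: (subbimod_sum bimod_unit_subbimod) => p /hl [p1 p2].
    exact: eqB (coinv_mul dd p1 p2).
  move=> [b ->]; have := gen _ _ dd; rewrite -[i b]mulr1.
  by have [_ _ + _] := bimod_prod_subbimod (coinv_subbimod cd) (coinv_subbimod cd'); apply.
move=> ee; have [[ce _ _] [ce' _ _] _ _] := ee; split.
- exact: coinv_subbimod.
- exact: coinv_subbimod.
- exact: half.
- exact/half/inverse_grouplike_sym.
Qed.

(** The map [a (x) b (x) c |-> a e b e c], which is [F (x)_S F] on threefold tensors for
    [F = insert e]. *)
Lemma bal_insert3 (G : zmodType) (psi : S -> S -> S -> G) e : central e ->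
  balanced3 psi ->
  balanced3 (fun a b c => \sum_(p <- e) \sum_(q <- e)
    psi (a * p.1) (p.2 * b * q.1) (q.2 * c)).
Proof.
move=> ce hpsi; have [h1 h2 h3 h4 h5] := hpsi; split.
- move=> *; rewrite -big_split; apply: eq_bigr => p _; rewrite -big_split.
  by apply: eq_bigr => q _; rewrite mulrDl h1.
- move=> *; rewrite -big_split; apply: eq_bigr => p _; rewrite -big_split.
  by apply: eq_bigr => q _; rewrite mulrDr mulrDl h2.
- move=> *; rewrite -big_split; apply: eq_bigr => p _; rewrite -big_split.
  by apply: eq_bigr => q _; rewrite mulrDr h3.
- move=> a x b c; rewrite exchange_big [RHS]exchange_big; apply: eq_bigr => q _.
  have := bal_insert ce (bal_ract q.1 (balanced3_12 (q.2 * c) hpsi)).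
  by case=> _ _ /(_ a x b).
- move=> a b x c; apply: eq_bigr => p _.
  have := bal_insert ce (bal_lact p.2 (balanced3_23 (a * p.1) hpsi)).
  case=> _ _ /(_ b x c) h.
  transitivity (\sum_(q <- e) psi (a * p.1) (p.2 * (b * i x * q.1)) (q.2 * c)).
    by apply: eq_bigr => q _; rewrite !mulrA.
  by rewrite h; apply: eq_bigr => q _; rewrite !mulrA.
Qed.

(** Let [F = insert e] and evaluate [F^-1 (x)_S F^-1] on [Delta(F(e'))]. Since [F(e') = 1 (x) 1],
    this is [e' (x)_S e']; since [F] is comultiplicative, cancelling [F^-1 F] in both factors gives
    [Delta(e')]. *)
Lemma inverse_comultiplicative e e' : central e -> central e' ->
  comultiplicative e -> teqSS i (insert e e') [:: (1, 1)] ->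
  teqSS i (insert e' e) [:: (1, 1)] -> comultiplicative e'.
Proof.
move=> ce ce' me h h' G psi hpsi.
have hpsi' := bal_insert3 ce' hpsi.
have := h _ _ (balanced3_13 hpsi'); rewrite big_allpairs_dep big_seq1 /=.
under [in X in _ = X -> _]eq_bigr do (under eq_bigr do rewrite mul1r !mulr1).
move=> <-; apply: eq_bigr => m _.
rewrite (me _ _ (balanced3_act m.1 m.2 hpsi')) exchange_big /=.
(* The cancellation in the right-hand factor; the left-hand one follows for fixed [j] and [n]. *)
transitivity (\sum_(j <- e) \sum_(n <- e') psi m.1 (j.1 * n.1) (n.2 * j.2 * m.2)).
  have := h' _ _ (bal_ract m.2 (balanced3_23 m.1 hpsi)).
  by rewrite big_allpairs_dep big_seq1 /= mul1r => ->.
apply: eq_bigr => j _; under [RHS]eq_bigr do rewrite exchange_big /=.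
rewrite exchange_big /=; apply: eq_bigr => n _.
have := h' _ _ (bal_act m.1 (j.1 * n.1) (balanced3_12 (n.2 * j.2 * m.2) hpsi)).
rewrite big_allpairs_dep big_seq1 /= mul1r mulr1 => <-; apply: eq_bigr => k _.
by apply: eq_bigr => l _; rewrite !mulrA.
Qed.

Lemma cor_aut_grouplike F : is_cor_aut i F ->
  exists e e', inverse_grouplike e e' /\ forall l, teqSS i (F l) (insert e l).
Proof.
move=> [FE [FD [Fl [Fr [[G [GE FG]] [Fu Fm]]]]]].
pose e := F [:: (1, 1)]; pose e' := G [:: (1, 1)].
have F0 : teqSS i (F [::]) [::].
  move=> H phi hphi; have := FD [::] [::] _ _ hphi; rewrite big_cat big_nil /= => h.
  by apply: (addrI (\sum_(p <- F [::]) phi p.1 p.2)); rewrite -h addr0.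
have Fe l : teqSS i (F l) (insert e l).
  elim: l => [|p l IHl]; first exact: F0.
  rewrite -cat1s insert_cat; apply: teqSS_trans (FD _ _) _; apply: teqSS_cat => //.
  have -> : [:: p] = lact p.1 (ract [:: (1, 1)] p.2).
    by case: p => a b; rewrite /lact /ract /= mulr1 mul1r.
  apply: teqSS_trans (Fl _ _) _; apply: teqSS_trans (teqSS_lact _ (Fr _ _)) _.
  apply: (teqSS_trans _ (teqSS_sym (insert_lact _ _ _))).
  apply: teqSS_lact; apply: (teqSS_trans _ (teqSS_sym (insert_ract _ _ _))).
  by apply: teqSS_ract; apply: teqSS_sym; apply: insert_unit.
have Finj l l' : teqSS i (F l) (F l') -> teqSS i l l'.
  move=> /GE h; apply: teqSS_trans (teqSS_sym (FG l).2) _.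
  exact: teqSS_trans h (FG l').2.
have ce : central e.
  move=> b; apply: teqSS_trans (teqSS_sym (Fl _ _)) _.
  apply: (teqSS_trans _ (Fr _ _)); apply: FE => H phi [_ _ h3].
  by have := h3 1 b 1; rewrite !big_seq1 /= /raS /laS !mulr1 !mul1r.
have Fe' : teqSS i (F e') [:: (1, 1)] := (FG _).1.
have ee' : teqSS i (insert e e') [:: (1, 1)] by apply: teqSS_trans (teqSS_sym (Fe _)) _.
(* [F] is injective on tensors, so the identity is checked after applying [F], where [e'] becomes
   [1 (x) 1]. *)
have ce' : central e'.
  move=> b; apply: Finj; apply: teqSS_trans (Fl _ _) _.
  apply: (teqSS_trans _ (teqSS_sym (Fr _ _))).
  apply: teqSS_trans (teqSS_lact _ Fe') _.
  apply: (teqSS_trans _ (teqSS_sym (teqSS_ract _ Fe'))) => H phi [_ _ h3].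
  by have := h3 1 b 1; rewrite !big_seq1 /= /raS /laS !mulr1 !mul1r.
have e'e : teqSS i (insert e' e) [:: (1, 1)].
  apply: Finj; apply: teqSS_trans (Fe _) _.
  apply: teqSS_trans (insert_insert _ _ _) _.
  apply: teqSS_trans (insert_teqSSl _ ee') _; exact: insert1.
have ue : counit e = 1 by rewrite Fu /counit big_seq1 mulr1.
have me : comultiplicative e.
  move=> H psi hpsi.
  have := Fm [:: (1, 1)] _ _ (balanced3_4 hpsi); rewrite big_map /=.
  rewrite /tens_self /= cats0 big_allpairs_dep /= => h.
  rewrite -h; by apply: eq_bigr => p _; rewrite mulr1.
exists e, e'; split=> //; split=> //; split=> //.
  by rewrite -Fu (counit_teqSS Fe') /counit big_seq1 mulr1.
exact: inverse_comultiplicative ce ce' me ee' e'e.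
Qed.

Lemma cor_aut_Gamma F : sweedler_equalizer -> coinv_generate -> is_cor_aut i F ->
  exists I, is_invertible i I /\ forall l, teqSS i (Gamma i I l) (F l).
Proof.
move=> eqB gen /cor_aut_grouplike [e [e' [ee Fe]]].
have inv := coinv_inverse eqB gen ee; have [[ce _ _] _ _ _] := ee.
exists (coinv e); split; first by apply/invertibleP; exists (coinv e').
have [f [ff _]] := inverse_bimod_frame inv.
(* Write [l] as a sum of [s x (x) s'] with [x] in [coinv e]; there [Gamma] and [insert e] both take
   the value [s (x) x s']. *)
move=> l; have [t [tI [tl ty]]] := insert_Gamma_graph l ff.
apply: teqSS_trans (Gamma_insert _ ff) _; apply: (teqSS_trans _ (teqSS_sym (Fe _))).
apply: teqSS_trans (teqSS_sym ty) _; apply: (teqSS_trans _ (insert_teqSS ce tl)).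
move=> G phi hphi; rewrite sum_insert !big_map.
rewrite big_seq [RHS]big_seq; apply: eq_bigr => p /tI pI /=.
have := pI _ _ (bal_act p.1.1 p.2 hphi); rewrite big_seq1 big_map /= mulr1 => <-.
by apply: eq_bigr => q _; rewrite mulrA.
Qed.

Lemma Gamma_isomorphism : sweedler_equalizer -> coinv_generate ->
  [/\ (forall I, is_invertible i I -> is_cor_aut i (Gamma i I)),
      (forall I J, is_invertible i I -> is_invertible i J ->
         forall l, teqSS i (Gamma i (bimod_prod I J) l) (Gamma i I (Gamma i J l))),
      (forall I J, is_invertible i I -> is_invertible i J ->
         (forall l, teqSS i (Gamma i I l) (Gamma i J l)) -> set_eq I J) &
      (forall F, is_cor_aut i F ->
         exists I, is_invertible i I /\ forall l, teqSS i (Gamma i I l) (F l))].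
Proof.
move=> eqB gen; split.
- exact: Gamma_is_cor_aut.
- by move=> I J hI hJ l; apply: Gamma_prod.
- move=> I J hI hJ IJ s; split; apply: Gamma_subset => // l.
  by apply: teqSS_sym; apply: IJ.
- by move=> F; apply: cor_aut_Gamma.
Qed.
End Sweedler.

(** * The split case *)

Section Split.
Variables (B S : pzRingType) (i : {rmorphism B -> S}).

Notation bal := (balanced2 (raS i) (laS i)).

Definition bimod_projection (pi : S -> S) : Prop :=
  [/\ forall s t, pi (s + t) = pi s + pi t,
      forall b s, pi (i b * s) = i b * pi s, forall s b, pi (s * i b) = pi s * i b,
      pi 1 = 1 & forall s, bimod_unit i (pi s)].

Lemma direct_summand_projection :
  iB_direct_summand i -> exists pi, bimod_projection pi.
Proof.
move=> [J [[J0 JB Jl Jr] Jsum Jdir]].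
pose P s t := bimod_unit i t /\ J (s - t).
have /choice [pi piP] s : exists t, P s t.
  have [b [x [Jx ->]]] := Jsum s; exists (i b); split; first by exists b.
  by rewrite addrC addKr.
(* The [i(B)]-component is unique because [J] meets [i(B)] only in 0; every property of [pi] follows
   from this. *)
have P_uniq s t : P s t -> pi s = t.
  have [[b ->] Jb] := piP s; move=> [[c ->] Jc]; apply/eqP; rewrite -subr_eq0 -rmorphB.
  have e : i b - i c = (s - i c) - (s - i b) by rewrite opprB [RHS]addrC addrA subrK.
  by apply/eqP/Jdir; rewrite rmorphB e; apply: JB.
exists pi; split=> [s t|b s|s b||s]; last by case: (piP s).
- have [[b bE] Jb] := piP s; have [[c cE] Jc] := piP t; apply: P_uniq; split.
    by exists (b + c); rewrite rmorphD bE cE.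
  by rewrite opprD addrACA -[t - _]opprK; apply: (JB) => //; rewrite -sub0r; apply: JB.
- have [[c cE] Jc] := piP s; apply: P_uniq; split; last by rewrite -mulrBr; apply: Jl.
  by exists (b * c); rewrite rmorphM cE.
- have [[c cE] Jc] := piP s; apply: P_uniq; split; last by rewrite -mulrBl; apply: Jr.
  by exists (c * b); rewrite rmorphM cE.
- by apply: P_uniq; split; [exact: bimod_unit1 | rewrite subrr].
Qed.

Variable pi : S -> S.
Hypothesis pi_proj : bimod_projection pi.

Let piD s t : pi (s + t) = pi s + pi t. Proof. by case: pi_proj. Qed.
Let pil b s : pi (i b * s) = i b * pi s. Proof. by case: pi_proj. Qed.
Let pir s b : pi (s * i b) = pi s * i b. Proof. by case: pi_proj. Qed.
Let pi1 : pi 1 = 1. Proof. by case: pi_proj. Qed.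
Let piB s : bimod_unit i (pi s). Proof. by case: pi_proj. Qed.

Lemma bal_projl : bal (fun a b => pi a * b).
Proof.
split=> *; rewrite ?piD ?mulrDl ?mulrDr //.
by rewrite /raS /laS pir mulrA.
Qed.

Lemma bal_projr s : bal (fun a b => a * pi (b * s)).
Proof.
split=> *; rewrite ?mulrDl ?piD ?mulrDr //.
by rewrite /raS /laS -!mulrA pil.
Qed.

(** Apply [a (x) b |-> pi(a) b] to [s (x) 1 = 1 (x) s] to get [pi(s) = s]. *)
Lemma projection_equalizer : sweedler_equalizer i.
Proof.
move=> s /(_ _ _ bal_projl); rewrite !big_seq1 /= pi1 mulr1 mul1r => <-.
exact: piB.
Qed.

(** Apply [a (x) b (x) c |-> pi(s a) b (x) c] to [Delta(e) = e (x)_S e], with [z] the sum in the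
    statement. The right side becomes [z e]; the left becomes [1 (x) z], as values of [pi] cross the
    tensor sign. *)
Lemma coinv_projl e s : comultiplicative i e ->
  coinv i e (\sum_(p <- e) pi (s * p.1) * p.2).
Proof.
move=> me G phi hphi; have [h1 h2 h3] := hphi.
have hpsi : balanced3 i (fun a b c => phi (pi (s * a) * b) c).
  split=> *; rewrite ?mulrDr ?piD ?mulrDl ?mulrDr ?h1 ?h2 //.
    by rewrite mulrA pir mulrA.
  by rewrite mulrA [LHS]h3.
have := me _ _ hpsi.
rewrite big_seq1 (balanced2_sumr _ _ _ hphi) big_map /= => h.
transitivity (\sum_(p <- e) phi (pi (s * p.1) * 1) p.2).
  rewrite h exchange_big /=; apply: eq_bigr => q _.
  rewrite mulr_suml (balanced2_suml _ _ _ hphi); apply: eq_bigr => p _.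
  by rewrite mulrA.
apply: eq_bigr => p _; rewrite mulr1 -[pi _ in LHS]mul1r.
exact: bal_unit hphi (piB _).
Qed.

(** Mirror image of [coinv_projl]; through [coinvP] it puts [w] in [coinv] of the inverse
    element. *)
Lemma ract_projr e s : comultiplicative i e ->
  let w := \sum_(p <- e) p.1 * pi (p.2 * s) in
  teqSS i (ract e w) [:: (w, 1)].
Proof.
move=> me w G phi hphi; have [h1 h2 h3] := hphi.
have hpsi : balanced3 i (fun a b c => phi a (b * pi (c * s))).
  split=> *; rewrite ?mulrDl ?piD ?mulrDr ?h1 ?h2 //.
    by rewrite -mulrA [LHS]h3.
  by rewrite -!mulrA pil.
have := me _ _ hpsi.
rewrite big_seq1 (balanced2_suml _ _ _ hphi) big_map /= => h.
transitivity (\sum_(p <- e) phi p.1 (1 * pi (p.2 * s))).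
  rewrite h; apply: eq_bigr => q _.
  rewrite mulr_sumr (balanced2_sumr _ _ _ hphi); apply: eq_bigr => p _.
  by rewrite mulrA.
apply: eq_bigr => p _; rewrite mul1r -[X in phi p.1 X]mulr1; apply/esym.
exact: bal_unit hphi (piB _).
Qed.

Lemma projection_generate : coinv_generate i.
Proof.
move=> e e' ee; have [[ce ue me] [ce' ue' me'] h h'] := ee.
pose z s := \sum_(p <- e) pi (s * p.1) * p.2.
pose w s := \sum_(p <- e) p.1 * pi (p.2 * s).
have xw x s : coinv i e x -> x * w s = pi (x * s).
  move=> /(_ _ _ (bal_projr s)); rewrite big_seq1 big_map /= mul1r => <-.
  by rewrite mulr_sumr; apply: eq_bigr => p _; rewrite mulrA.
(* By [xw], the sum of [z(p.1) w(p.2)] over [e'] is [pi] of the sum of [z(p.1) p.2]. The latter is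
   the image of [insert e e' = 1 (x) 1] under [a (x) b |-> pi(a) b], namely 1. *)
have zI s : coinv i e (z s) by apply: coinv_projl.
exists [seq (z p.1, w p.2) | p <- e']; split.
  move=> _ /mapP [p _ ->]; split=> //=; apply/(coinvP _ (inverse_grouplike_sym ee)).
  exact: ract_projr.
have pi0 : pi 0 = 0 by apply: (addrI (pi 0)); rewrite -piD !addr0.
rewrite big_map /=; under eq_bigr do rewrite xw //.
rewrite -(big_morph _ piD pi0) -pi1; congr pi.
have := h _ _ bal_projl; rewrite big_allpairs_dep big_seq1 /= pi1 mul1r => <-.
by apply: eq_bigr => p _; rewrite mulr_suml; apply: eq_bigr => q _; rewrite mulrA.
Qed.

End Split.

(** * Passage to converse rings *)

Definition flip (M N : Type) (l : seq (M * N)) : seq (N * M) :=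
  [seq (p.2, p.1) | p <- l].

Lemma flipK (M N : Type) : cancel (@flip M N) (@flip N M).
Proof. by elim=> [|[a b] l IHl] //=; rewrite IHl. Qed.

Lemma flip_map (M M' N : Type) (k : M -> M') (l : seq (M * N)) :
  flip [seq (k p.1, p.2) | p <- l] = [seq (p.1, k p.2) | p <- flip l].
Proof. by rewrite /flip -!map_comp. Qed.

Lemma teq2_flip (B : Type) (M N : zmodType) (ra : M -> B -> M) (la : B -> N -> N) l l' :
  teq2 ra la l l' <->
  teq2 (fun n b => la b n) (fun b m => ra m b) (flip l) (flip l').
Proof.
split=> h G phi [h1 h2 h3].
  by have := h G (fun m n => phi n m); rewrite !big_map; apply; split.
have := h G (fun m n => phi n m); rewrite !big_map; apply; split=> //.
Qed.

Section Opposite.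
Variables (B S : pzRingType) (i : {rmorphism B -> S}).

Definition opp_mor : B^c -> S^c := i.

Lemma opp_mor_additive : {morph opp_mor : x y / x - y}.
Proof. exact: (rmorphB i). Qed.

Lemma opp_mor_monoid : monoid_morphism opp_mor.
Proof. by split=> [|x y]; [apply: (rmorph1 i) | apply: (rmorphM i)]. Qed.

HB.instance Definition _ := GRing.isZmodMorphism.Build B^c S^c opp_mor opp_mor_additive.
HB.instance Definition _ := GRing.isMonoidMorphism.Build B^c S^c opp_mor opp_mor_monoid.

Notation ic := (opp_mor : {rmorphism B^c -> S^c}).

Lemma teqSS_flip (l l' : seq (S * S)) :
  teqSS i l l' <-> teqSS ic (flip l : seq (S^c * S^c)) (flip l').
Proof. exact: teq2_flip. Qed.

Lemma flat_left_opp : faithfully_flat_left i -> faithfully_flat_right ic.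
Proof.
move=> ff N1 N2 N3 f g; rewrite ff.
pose sc (N : lmodType B^c) (n : N) (b : B) := (b : B^c) *: n.
have ker_flip l : teq2 (@sc N3) (laS i) [seq (g p.1, p.2) | p <- l] [::] <->
    teq2 (raS ic) (fun b n => sc N3 n b) [seq (p.1, g p.2) | p <- flip l] [::].
  by rewrite teq2_flip flip_map.
have im_flip l : (exists l1, teq2 (@sc N2) (laS i) [seq (f p.1, p.2) | p <- l1] l) <->
    exists l1, teq2 (raS ic) (fun b n => sc N2 n b) [seq (p.1, f p.2) | p <- l1] (flip l).
  split=> [[l1]|[l1 hl1]]; first by rewrite teq2_flip flip_map; exists (flip l1).
  by exists (flip l1); rewrite teq2_flip flip_map flipK.
split=> h l.
  rewrite -(flipK l).
  exact: iff_trans (iff_sym (ker_flip _)) (iff_trans (h _) (im_flip _)).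
exact: iff_trans (ker_flip _) (iff_trans (h _) (iff_sym (im_flip _))).
Qed.

Lemma equalizer_opp : sweedler_equalizer ic -> sweedler_equalizer i.
Proof. by move=> h s hs; apply: h; apply: teqSS_sym; exact: (teqSS_flip _ _).1 hs. Qed.

Lemma grouplike_opp e : grouplike i e -> grouplike ic (flip e : seq (S^c * S^c)).
Proof.
move=> [ce ue me]; split.
- move=> b; have := teqSS_sym (ce b); rewrite teqSS_flip.
  by rewrite /flip /lact /ract -!map_comp.
- by rewrite /counit big_map; apply: ue.
- move=> G psi [h1 h2 h3 h4 h5]; have := me G (fun a b c => psi c b a).
  rewrite !big_map => -> //.
    by rewrite exchange_big; apply: eq_bigr => p _; rewrite big_map.
  by split=> // [a x b c|a b x c]; apply: esym; [apply: h5 | apply: h4].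
Qed.

Lemma flip_insert (e l : seq (S * S)) :
  flip (insert e l) = insert (flip e : seq (S^c * S^c)) (flip l : seq (S^c * S^c)).
Proof.
rewrite /flip /insert map_flatten -!map_comp; congr flatten.
by apply: eq_map => p /=; rewrite -!map_comp.
Qed.

Lemma inverse_grouplike_opp e e' : inverse_grouplike i e e' ->
  inverse_grouplike ic (flip e : seq (S^c * S^c)) (flip e').
Proof.
move=> [ge ge' h h']; split; try exact: grouplike_opp.
  by move: h; rewrite teqSS_flip flip_insert.
by move: h'; rewrite teqSS_flip flip_insert.
Qed.

(** Over the converse rings, the condition on [flip e] reads [e s = s (x) 1], which by [coinvP]
    describes [coinv] of [e']: the two bimodules trade places. *)
Lemma coinv_opp e e' s : inverse_grouplike i e e' ->
  coinv ic (flip e : seq (S^c * S^c)) s -> coinv i e' s.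
Proof.
move=> ee hs; apply/(coinvP _ (inverse_grouplike_sym ee))/teqSS_flip.
by move: hs; rewrite /coinv /flip /lact /ract -!map_comp.
Qed.

Lemma generate_opp : coinv_generate ic -> coinv_generate i.
Proof.
move=> h e e' ee; have [l [hl l1]] := h _ _ (inverse_grouplike_opp ee).
exists (flip l); split; last by rewrite big_map [LHS]l1.
move=> _ /mapP [p /hl [p1 p2] ->]; split=> /=; last exact: coinv_opp ee p1.
exact: coinv_opp (inverse_grouplike_sym ee) p2.
Qed.

End Opposite.

(** * The flat case *)

Section Submodules.
Variables (R : pzRingType) (V : lmodType R).

(** Flatness speaks of module types, so a [Prop]-valued submodule is bundled here to be turned into
    an [lmodType] via [asbool]. *)
Record submodule := Submodule {
  submod_mem : V -> Prop;
  submod_memP : submod_mem 0 /\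
    forall a u v, submod_mem u -> submod_mem v -> submod_mem (a *: u + v) }.

Definition submod_pred (P : submodule) : {pred V} := fun v => `[< submod_mem P v >].

Lemma submod_pred_closed P : submod_closed (submod_pred P).
Proof.
have [P0 PD] := submod_memP P; split=> [|a u v /asboolP Pu /asboolP Pv]; apply/asboolP => //.
exact: PD.
Qed.

HB.instance Definition _ P :=
  GRing.isSubmodClosed.Build R V (submod_pred P) (submod_pred_closed P).

Record submod_type (P : submodule) :=
  SubmodElt { submod_val : V; _ : submod_val \in submod_pred P }.

HB.instance Definition _ P := [isSub for @submod_val P].
HB.instance Definition _ P := [Choice of submod_type P by <:].
HB.instance Definition _ P := [SubChoice_isSubLmodule of submod_type P by <:].

Definition submod_elt (P : submodule) v (Pv : submod_mem P v) : submod_type P :=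
  @SubmodElt P v (asboolT Pv).

Lemma submod_valP (P : submodule) (x : submod_type P) : submod_mem P (val x).
Proof. by case: x => v Pv; apply: asboolW Pv. Qed.

Section Inclusion.
Variables (P Q : submodule) (PQ : forall v, submod_mem P v -> submod_mem Q v).

Definition submod_incl (x : submod_type P) : submod_type Q :=
  submod_elt (PQ (submod_valP x)).

Lemma submod_incl_linear : linear submod_incl.
Proof. by move=> a x y; apply: val_inj; rewrite [RHS]linearP [LHS]linearP. Qed.

HB.instance Definition _ :=
  GRing.isLinear.Build R (submod_type P) (submod_type Q) _ submod_incl submod_incl_linear.

End Inclusion.

Lemma submod_lift (T : eqType) (P : submodule) (l : seq (T * V)) :
  (forall p, p \in l -> submod_mem P p.2) ->
  exists l' : seq (T * submod_type P), [seq (p.1, val p.2) | p <- l'] = l.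
Proof.
elim: l => [|[t v] l IHl] lP; first by exists [::].
have [|l' <-] := IHl; first by move=> p pl; apply: lP; rewrite inE pl orbT.
have Pv : submod_mem P v by apply: (lP (t, v)); rewrite inE eqxx.
by exists ((t, submod_elt Pv) :: l').
Qed.

End Submodules.

(** * [S] and [S (x)_B S] as left [B]-modules *)

Section Restriction.
Variables (B S : pzRingType) (i : {rmorphism B -> S}).

(** A copy of [S] indexed by [i], so that the [B]-module structure induced by [i] can be attached to
    it. *)
Definition restriction of {rmorphism B -> S} : Type := S.
HB.instance Definition _ := GRing.Zmodule.copy (restriction i) S.

Definition restr_scale (b : B) (s : restriction i) : restriction i := i b * s.

Lemma restr_scaleA a b v : restr_scale a (restr_scale b v) = restr_scale (a * b) v.
Proof. by rewrite /restr_scale rmorphM mulrA. Qed.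
Lemma restr_scale1 : left_id 1 restr_scale.
Proof. by move=> v; rewrite /restr_scale rmorph1 mul1r. Qed.
Lemma restr_scaleDr : right_distributive restr_scale +%R.
Proof. by move=> a u v; apply: mulrDr. Qed.
Lemma restr_scaleDl v : {morph restr_scale^~ v : a b / a + b}.
Proof. by move=> a b; rewrite /restr_scale rmorphD mulrDl. Qed.

HB.instance Definition _ := GRing.Zmodule_isLmodule.Build B (restriction i)
  restr_scaleA restr_scale1 restr_scaleDr restr_scaleDl.

Definition teqSSb : rel (seq (S * S)) := fun l l' => `[< teqSS i l l' >].

Lemma teqSSb_equiv : equiv_class_of teqSSb.
Proof.
split=> [l|l l'|l l' l'']; first by apply/asboolP.
  by apply/asboolP/asboolP; apply: teqSS_sym.
by move=> /asboolP h /asboolP h'; apply/asboolP; apply: teqSS_trans h h'.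
Qed.

Canonical teqSSb_equivRel := EquivRelPack teqSSb_equiv.

(** An actual module is needed as target of the [B]-linear map with kernel [coinv e]. *)
Definition tensSS : Type := {eq_quot teqSSb_equivRel}.
HB.instance Definition _ := Choice.on tensSS.

Definition tens (l : seq (S * S)) : tensSS := \pi_({eq_quot teqSSb_equivRel}) l.
Definition tens_repr (x : tensSS) : seq (S * S) := repr (x : {eq_quot teqSSb_equivRel}).

Lemma tensP l l' : tens l = tens l' <-> teqSS i l l'.
Proof. by split=> [/eqmodP /asboolP //|h]; apply/eqmodP/asboolP. Qed.

Lemma tens_reprK x : tens (tens_repr x) = x.
Proof. exact: reprK. Qed.

Lemma teqSS_repr l : teqSS i (tens_repr (tens l)) l.
Proof. by apply/tensP; rewrite tens_reprK. Qed.

Lemma tensW (P : tensSS -> Prop) : (forall l, P (tens l)) -> forall x, P x.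
Proof. by move=> h x; rewrite -(tens_reprK x). Qed.

Definition tens_add x y := tens (tens_repr x ++ tens_repr y).
Definition tens_neg x := tens (tens_opp (tens_repr x)).
Definition tens_scale b x := tens (lact (i b) (tens_repr x)).

Lemma tens_addE l l' : tens_add (tens l) (tens l') = tens (l ++ l').
Proof. by apply/tensP/teqSS_cat; apply: teqSS_repr. Qed.

Lemma tens_negE l : tens_neg (tens l) = tens (tens_opp l).
Proof. by apply/tensP=> G phi hphi; rewrite !(tens_oppE _ hphi) teqSS_repr. Qed.

Lemma tens_scaleE b l : tens_scale b (tens l) = tens (lact (i b) l).
Proof. by apply/tensP/teqSS_lact/teqSS_repr. Qed.

Lemma tens_addA : associative tens_add.
Proof.
elim/tensW=> x; elim/tensW=> y; elim/tensW=> z.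
by rewrite !tens_addE catA.
Qed.

Lemma tens_addC : commutative tens_add.
Proof.
elim/tensW=> x; elim/tensW=> y; rewrite !tens_addE.
by apply/tensP=> G phi _; rewrite !big_cat /= addrC.
Qed.

Lemma tens_add0 : left_id (tens [::]) tens_add.
Proof. by elim/tensW=> x; rewrite tens_addE. Qed.

Lemma tens_addN : left_inverse (tens [::]) tens_neg tens_add.
Proof.
elim/tensW=> x; rewrite tens_negE tens_addE; apply/tensP=> G phi hphi.
by rewrite big_cat /= (tens_oppE _ hphi) addNr big_nil.
Qed.

HB.instance Definition _ := GRing.isZmodule.Build tensSS
  tens_addA tens_addC tens_add0 tens_addN.

Lemma tens_cat l l' : tens (l ++ l') = tens l + tens l'.
Proof. exact/esym/tens_addE. Qed.

Lemma tens_scaleA a b v : tens_scale a (tens_scale b v) = tens_scale (a * b) v.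
Proof.
elim/tensW: v => l; rewrite !tens_scaleE /lact -map_comp rmorphM; congr tens.
by apply: eq_map => p /=; rewrite mulrA.
Qed.

Lemma tens_scale1 : left_id 1 tens_scale.
Proof.
elim/tensW=> l; rewrite tens_scaleE rmorph1; congr tens.
by rewrite -[RHS]map_id; apply: eq_map => -[a b]; rewrite mul1r.
Qed.

Lemma tens_scaleDr : right_distributive tens_scale +%R.
Proof.
move=> b; elim/tensW=> x; elim/tensW=> y.
by rewrite -tens_cat !tens_scaleE /lact map_cat tens_cat.
Qed.

Lemma tens_scaleDl v : {morph tens_scale^~ v : a b / a + b}.
Proof.
move=> a b; elim/tensW: v => l; rewrite !tens_scaleE -tens_cat.
apply/tensP=> G phi [h1 _ _]; rewrite big_cat /= !big_map -big_split /=.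
by apply: eq_bigr => p _ /=; rewrite rmorphD mulrDl h1.
Qed.

HB.instance Definition _ := GRing.Zmodule_isLmodule.Build B tensSS
  tens_scaleA tens_scale1 tens_scaleDr tens_scaleDl.

End Restriction.

(** * Consequences of right faithful flatness *)

Section RightFlat.
Variables (B S : pzRingType) (i : {rmorphism B -> S}).
Hypothesis flat : faithfully_flat_right i.

Notation teqS := (teq2 (raS i) (fun b n => b *: n)).

(** Tensoring the exact sequence [0 -> P -> V] keeps it exact: the difference of [l] and [l'] lifts
    to [S (x)_B 0], hence vanishes. *)
Lemma tensor_submod_inj (V : lmodType B) (P : submodule V)
    (l l' : seq (S * submod_type P)) :
  teqS [seq (p.1, val p.2) | p <- l] [seq (p.1, val p.2) | p <- l'] -> teqS l l'.
Proof.
move=> h; have ex : exact3 (\0 : {linear 'rV[B]_0 -> submod_type P})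
    (val : {linear submod_type P -> V}).
  move=> y; split=> [y0|[x <-]]; last by rewrite [LHS]linear0.
  by exists 0; apply: val_inj; rewrite [RHS]y0 linear0.
have hk : teqS [seq (p.1, val p.2) | p <- l ++ tens_opp l'] [::].
  move=> G phi hphi; rewrite map_cat big_cat big_nil /=.
  have -> : [seq (p.1, val p.2) | p <- tens_opp l']
      = tens_opp [seq (p.1, val p.2) | p <- l'] by rewrite /tens_opp -!map_comp.
  by rewrite (tens_oppE _ hphi) (h _ _ hphi) subrr.
have [l1 hl1] := ((flat _ _).1 ex (l ++ tens_opp l')).1 hk.
move=> G phi hphi; apply/eqP; rewrite -subr_eq0 -(tens_oppE _ hphi) -big_cat /=.
rewrite -hl1 // big_map big1 // => p _; exact: balanced2_0r hphi.
Qed.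

(* Faithful flatness reflects the exactness of [P -> Q -> 0]. *)
Lemma flat_submod_sub (V : lmodType B) (P Q : submodule V) :
  (forall v, submod_mem P v -> submod_mem Q v) ->
  (forall s v, submod_mem Q v -> exists l : seq (S * V),
     (forall p, p \in l -> submod_mem P p.2) /\ teqS l [:: (s, v)]) ->
  forall v, submod_mem Q v -> submod_mem P v.
Proof.
move=> PQ gen v Qv.
have ex : exact3 (submod_incl PQ : {linear submod_type P -> submod_type Q})
    (\0 : {linear submod_type Q -> 'rV[B]_0}); last first.
  have [x xE] := (ex (submod_elt Qv)).1 erefl.
  by have := submod_valP x; have := congr1 val xE => /= ->.
apply/flat => l; split=> _; last first.
  by move=> G phi hphi; rewrite big_map big_nil big1 // => p _; apply: balanced2_0r hphi.
elim: l => [|[s q] l [l1 hl1]]; first by exists [::].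
have [l' [l'P l'E]] := gen s _ (submod_valP q).
have [l2 l2E] := submod_lift l'P; exists (l2 ++ l1).
(* The hypothesis [gen] gives an equality in [S (x)_B V]; injectivity of [S (x)_B Q -> S (x)_B V]
   brings it down to [S (x)_B Q]. *)
have hl2 : teqS [seq (p.1, submod_incl PQ p.2) | p <- l2] [:: (s, q)].
  by apply: tensor_submod_inj; rewrite -map_comp /= l2E.
move=> G phi hphi; rewrite -cat1s map_cat !big_cat /=.
by congr (_ + _); [apply: hl2 | apply: hl1].
Qed.

Lemma subbimod_restr (I : S -> Prop) : is_subbimod i I ->
  I 0 /\ forall (a : B) (u v : restriction i), I u -> I v -> I (a *: u + v).
Proof.
move=> [I0 IB Il _]; split=> // a u v Iu Iv.
by rewrite -[v]opprK; apply: (IB); [apply: Il | rewrite -sub0r; apply: IB].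
Qed.

Definition subbimod_submodule I (sI : is_subbimod i I) : submodule (restriction i) :=
  Submodule (subbimod_restr sI).

Lemma flat_subbimod_sub (P Q : S -> Prop) : is_subbimod i P -> is_subbimod i Q ->
  (forall s, P s -> Q s) ->
  (forall s v, Q v -> exists l : seq (S * S),
     (forall p, p \in l -> P p.2) /\ teqSS i l [:: (s, v)]) ->
  forall s, Q s -> P s.
Proof.
by move=> sP sQ; apply: (@flat_submod_sub (restriction i) (subbimod_submodule sP)
  (subbimod_submodule sQ)).
Qed.

Lemma equalizer_subbimod :
  is_subbimod i (fun s => teqSS i [:: (s, 1)] [:: (1, s)]).
Proof.
have -> : (fun s => teqSS i [:: (s, 1)] [:: (1, s)]) = coinv i [:: (1, 1)].
  by apply/funext => s; rewrite /coinv /lact /= mulr1.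
apply: coinv_subbimod => b G phi [_ _ h3]; rewrite !big_seq1 /=.
by have := h3 1 b 1; rewrite /raS /laS !mulr1 !mul1r.
Qed.

(** For [v] in the equalizer, [s (x) v = s v (x) 1] and 1 lies in [i(B)]; so [i(B)] and the
    equalizer agree after [S (x)_B -]. *)
Lemma flat_equalizer : sweedler_equalizer i.
Proof.
apply: (flat_subbimod_sub (bimod_unit_subbimod i) equalizer_subbimod).
  move=> _ [b ->] G phi [_ _ h3]; rewrite !big_seq1 /=.
  by have := h3 1 b 1; rewrite /raS /laS mulr1 mul1r.
move=> s v hv; exists [:: (s * v, 1)]; split.
  by move=> p; rewrite inE => /eqP ->; apply: bimod_unit1.
by have := teqSS_lact s hv; rewrite /lact /= mulr1.
Qed.

Section Coinvariants.
Variable e : seq (S * S).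
Hypothesis ce : central i e.

Definition coinv_map (s : restriction i) : tensSS i :=
  tens i (lact (s : S) e) - tens i [:: (1, s : S)].

Lemma coinv_map_linear : linear coinv_map.
Proof.
move=> b s t; rewrite /coinv_map scalerBr addrACA -opprD; congr (_ - _).
  have -> : b *: tens i (lact (s : S) e) = tens i (lact (i b) (lact (s : S) e)).
    exact: tens_scaleE.
  rewrite -tens_cat; apply/tensP => G phi [h1 _ _].
  rewrite big_cat /= !big_map -big_split; apply: eq_bigr => p _ /=.
  by rewrite mulrDl h1 mulrA.
have -> : b *: tens i [:: (1, s : S)] = tens i [:: (i b * 1, s : S)].
  exact: tens_scaleE.
rewrite -tens_cat; apply/tensP => G phi [_ h2 h3].
rewrite big_seq1 big_cons big_seq1 /= h2; congr (_ + _).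
by have := h3 1 b s; rewrite /raS /laS mulr1 mul1r => ->.
Qed.

HB.instance Definition _ :=
  GRing.isLinear.Build B (restriction i) (tensSS i) _ coinv_map coinv_map_linear.

Lemma coinv_map_eq0 s : coinv_map s = 0 <-> coinv i e s.
Proof.
by rewrite /coinv -tensP; split=> [/subr0_eq//|h]; rewrite /coinv_map h subrr.
Qed.

(** [S (x) coinv_map] sends [e] to [e (x)_S e - Delta(e) = 0], and flatness keeps
    [coinv e -> S -> S (x)_B S] exact. *)
Lemma coinv_lift : comultiplicative i e ->
  exists l, (forall p, p \in l -> coinv i e p.2) /\ teqSS i l e.
Proof.
move=> me; pose P := subbimod_submodule (coinv_subbimod ce).
have ex : exact3 (val : {linear submod_type P -> restriction i})
    (coinv_map : {linear restriction i -> tensSS i}).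
  move=> y; rewrite coinv_map_eq0; split=> [hy|[x <-]].
    by exists (@submod_elt _ _ P y hy).
  exact: (submod_valP x).
have he : teqS [seq (p.1, coinv_map p.2) | p <- e : seq (S * restriction i)] [::].
  move=> G phi hphi; have [h1 h2 h3] := hphi; rewrite big_map big_nil /=.
  have phi_tens a l : phi a (tens i l) = \sum_(p <- l) phi a (tens i [:: p]).
    elim: l => [|p l IHl]; first by rewrite big_nil; apply: balanced2_0r hphi.
    by rewrite big_cons -IHl -cat1s tens_cat h2.
  (* A balanced map on [S] and [S (x)_B S] is a threefold balanced map, to which [me] applies. *)
  have hpsi : balanced3 i (fun a b c => phi a (tens i [:: (b, c)])).
    split=> [a a' b c|a b b' c|a b c c'|a x b c|a b x c].
    - exact: h1.
    - rewrite -h2 -tens_cat; congr phi; apply/tensP => H psi [k1 _ _].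
      by rewrite big_seq1 big_cons big_seq1 k1.
    - rewrite -h2 -tens_cat; congr phi; apply/tensP => H psi [_ k2 _].
      by rewrite big_seq1 big_cons big_seq1 k2.
    - by rewrite [LHS]h3; congr phi; rewrite [LHS]tens_scaleE.
    - by congr phi; apply/tensP => H psi [_ _ k3]; rewrite !big_seq1 [LHS]k3.
  have := me _ _ hpsi => /= me1.
  transitivity (\sum_(p <- e) (\sum_(q <- e) phi p.1 (tens i [:: (p.2 * q.1, q.2)])
    - phi p.1 (tens i [:: (1, p.2)]))); last by rewrite sumrB me1 subrr.
  apply: eq_bigr => p _; rewrite /coinv_map h2 phi_tens big_map; congr (_ + _).
  by apply: (addrI (phi p.1 (tens i [:: (1, p.2)]))); rewrite -h2 !subrr (balanced2_0r _ hphi).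
have [l1 hl1] := ((flat _ _).1 ex (e : seq (S * restriction i))).1 he.
exists [seq (p.1, val p.2) | p <- l1]; split=> // _ /mapP [p _ ->].
exact: (submod_valP p.2).
Qed.

End Coinvariants.

(** Descent from [i(B)] to [IJ]: it suffices that tensors [s (x) v] with [v] in [i(B)] come from
    [S (x)_B IJ]; the conclusion is then read at 1. *)
Lemma flat_generate : coinv_generate i.
Proof.
move=> e e' ee; have [[ce ue me] [ce' ue' me'] _ _] := ee.
have [l [lI le]] := coinv_lift ce me; have [l' [lI' le']] := coinv_lift ce' me'.
have Il := coinv_subbimod ce; have Jl := coinv_subbimod ce'.
have IJB s : bimod_prod (coinv i e) (coinv i e') s -> bimod_unit i s.
  move=> [r [rIJ ->]]; apply: (subbimod_sum (bimod_unit_subbimod i)) => p /rIJ [p1 p2].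
  exact: flat_equalizer (coinv_mul ee p1 p2).
apply: (flat_subbimod_sub (bimod_prod_subbimod Il Jl)
  (bimod_unit_subbimod i)) => //; last first.
  exact: bimod_unit1.
(* The right entries of [m] lie in [IJ], hence in [i(B)], and its counit is 1; so
   [s v m = s v (x) 1 = s (x) v]. *)
pose m := insert l l'.
have m1 : counit m = 1.
  by rewrite counit_insert ?(counit_teqSS le') ?(counit_teqSS le).
have mIJ p : p \in m -> bimod_prod (coinv i e) (coinv i e') p.2.
  by move=> /allpairsP [[p1 p2] [h1 h2 ->]]; apply: mem_bimod_prod; [apply: lI | apply: lI'].
move=> s v vB; exists (lact (s * v) m); split.
  by move=> _ /mapP [p pm ->]; exact: (mIJ p).
move=> G phi hphi; rewrite big_map big_seq1 /=.
transitivity (\sum_(p <- m) phi (s * v * (p.1 * p.2)) 1).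
  rewrite big_seq [RHS]big_seq; apply: eq_bigr => p pm.
  by rewrite mulrA (bal_unit _ _ hphi (IJB _ (mIJ _ pm))) mulr1.
rewrite -(balanced2_suml _ _ _ hphi) -mulr_sumr; move: m1; rewrite /counit => ->.
by rewrite mulr1 (bal_unit _ _ hphi vB) mulr1.
Qed.

End RightFlat.

Theorem theorem3p10 (B S : pzRingType) (i : {rmorphism B -> S}) :
  (faithfully_flat_left i \/ faithfully_flat_right i \/ iB_direct_summand i) ->
  [/\ (* Gamma lands in Aut_cor(S (x)_B S) *)
      (forall I, is_invertible i I -> is_cor_aut i (Gamma i I)),
      (* Gamma is a group homomorphism *)
      (forall I J, is_invertible i I -> is_invertible i J ->
         forall l, teqSS i (Gamma i (bimod_prod I J) l) (Gamma i I (Gamma i J l))),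
      (* Gamma is injective *)
      (forall I J, is_invertible i I -> is_invertible i J ->
         (forall l, teqSS i (Gamma i I l) (Gamma i J l)) -> set_eq I J) &
      (* Gamma is surjective *)
      (forall F, is_cor_aut i F ->
         exists I, is_invertible i I /\ forall l, teqSS i (Gamma i I l) (F l))].
Proof.
case=> [/flat_left_opp flat|[flat|/direct_summand_projection [pi pi_proj]]].
- apply: Gamma_isomorphism; first exact: equalizer_opp (flat_equalizer flat).
  exact: generate_opp (flat_generate flat).
- exact: Gamma_isomorphism (flat_equalizer flat) (flat_generate flat).
- apply: Gamma_isomorphism; first exact: projection_equalizer pi_proj.
  exact: projection_generate pi_proj.
Qed.
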